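(* Let $n,b$ be positive integers with $b\le n-2$. If $G$ is a graph of order $n$ with exactly $b$ bridges, and $G$ is not isomorphic to $J_{n,b}$, then $$\eta(G) < \eta(J_{n,b}).$$
   Context: All graphs are finite and simple (undirected, no loops or multiple edges). The order of $G$ is $|V(G)|$. For a graph $G$, $\eta(G)$ denotes the number of connected induced subgraphs of $G$, i.e. the number of nonempty subsets $S\subseteq V(G)$ such that the subgraph of $G$ induced by $S$ is connected. A bridge of $G$ is an edge whose deletion increases the number of components of $G$. $K_m$ denotes the complete graph of order $m$ and $S_m$ the star of order $m$ (one central vertex adjacent to $m-1$ other vertices, with no other edges). For positive integers $b,n$ with $b<n-2$, $J_{n,b}$ is the graph obtained by identifying one vertex of $K_{n-b}$ with the central vertex of $S_{b+1}$. For $b=n-2$, $J_{n,b}$ is the graph obtained by inserting one vertex into an edge of $S_{n-1}$ (i.e. subdividing one edge of $S_{n-1}$ once). *)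

(* Defs.v *)
From mathcomp Require Import all_boot.

Set Implicit Arguments.
Unset Strict Implicit.
Unset Printing Implicit Defensive.

Record sgraph := SGraph {
  vertex :> finType;
  adj : rel vertex;
  adj_sym : symmetric adj;
  adj_irr : irreflexive adj }.

Arguments adj {s} x y.

Definition isomorphic (G H : sgraph) : Prop :=
  exists2 f : G -> H, bijective f & forall x y : G, adj (f x) (f y) = adj x y.

Definition connected (G : sgraph) : bool := [forall x : G, forall y : G, connect adj x y].

Definition components (G : sgraph) : nat := n_comp (@adj G) predT.

Section Induced.
Variables (G : sgraph) (S : {set G}).
Definition induced_adj : rel {x : G | x \in S} := fun x y => adj (val x) (val y).
Fact induced_sym : symmetric induced_adj.
Proof. by move=> x y; exact: adj_sym. Qed.
Fact induced_irr : irreflexive induced_adj.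
Proof. by move=> x; exact: adj_irr. Qed.
Definition induced : sgraph := SGraph induced_sym induced_irr.
End Induced.

(* [connected] holds vacuously of the empty graph, hence the test S != set0. *)
Definition eta (G : sgraph) : nat :=
  #|[set S : {set G} | (S != set0) && connected (induced S)]|.

Definition edges (G : sgraph) : {set {set G}} :=
  [set [set x; y] | x in G, y in adj x].

Section DeleteEdge.
Variables (G : sgraph) (E : {set G}).
Definition delete_adj : rel G := fun x y => adj x y && ([set x; y] != E).
Fact delete_sym : symmetric delete_adj.
Proof. by move=> x y; rewrite /delete_adj adj_sym setUC. Qed.
Fact delete_irr : irreflexive delete_adj.
Proof. by move=> x; rewrite /delete_adj adj_irr. Qed.
Definition delete_edge : sgraph := SGraph delete_sym delete_irr.
End DeleteEdge.

Definition bridges (G : sgraph) : {set {set G}} :=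
  [set E in edges G | components G < components (delete_edge E)].

Section Complete.
Variable m : nat.
Definition complete_adj : rel 'I_m := fun x y => x != y.
Fact complete_sym : symmetric complete_adj.
Proof. by move=> x y; rewrite /complete_adj eq_sym. Qed.
Fact complete_irr : irreflexive complete_adj.
Proof. by move=> x; rewrite /complete_adj eqxx. Qed.
Definition complete : sgraph := SGraph complete_sym complete_irr.
End Complete.

(* The star of order m, with central vertex 0. *)
Section Star.
Variable m : nat.
Definition star_adj : rel 'I_m :=
  fun x y => (x != y) && ((val x == 0) || (val y == 0)).
Fact star_sym : symmetric star_adj.
Proof. by move=> x y; rewrite /star_adj eq_sym orbC. Qed.
Fact star_irr : irreflexive star_adj.
Proof. by move=> x; rewrite /star_adj eqxx. Qed.
Definition star : sgraph := SGraph star_sym star_irr.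
End Star.

(* Identification of the vertex u of G with the vertex v of H in the disjoint
   union of G and H: v is removed from H and u inherits its neighbours. *)
Section Identify.
Variables (G H : sgraph) (u : G) (v : H).
Definition identify_adj : rel (G + {y : H | y != v}) := fun p q =>
  match p, q with
  | inl x, inl y => adj x y
  | inr x, inr y => adj (val x) (val y)
  | inl x, inr y => (x == u) && adj v (val y)
  | inr x, inl y => (y == u) && adj v (val x)
  end.
Fact identify_sym : symmetric identify_adj.
Proof. by move=> [x|x] [y|y] //=; exact: adj_sym. Qed.
Fact identify_irr : irreflexive identify_adj.
Proof. by move=> [x|x] /=; exact: adj_irr. Qed.
Definition identify : sgraph := SGraph identify_sym identify_irr.
End Identify.

(* Insertion of a new vertex [None] into the edge uv. *)
Section Subdivide.
Variables (G : sgraph) (u v : G).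
Definition subdivide_adj : rel (option G) := fun p q =>
  match p, q with
  | Some x, Some y => adj x y && ([set x; y] != [set u; v])
  | Some x, None | None, Some x => x \in [set u; v]
  | None, None => false
  end.
Fact subdivide_sym : symmetric subdivide_adj.
Proof. by move=> [x|] [y|] //=; rewrite adj_sym setUC. Qed.
Fact subdivide_irr : irreflexive subdivide_adj.
Proof. by move=> [x|] //=; rewrite adj_irr. Qed.
Definition subdivide : sgraph := SGraph subdivide_sym subdivide_irr.
End Subdivide.

(* Meaningful for 0 < b and b + 2 <= n, in which case (n - b).-1.+1 = n - b and
   (n - 2).+1 = n - 1; the successors only make the vertex types inhabited.
   In the case b = n - 2, ord0 and ord_max are the ends of an edge of the star,
   and the resulting graph is a tree, which has n - 1 rather than b bridges. *)
Definition J (n b : nat) : sgraph :=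
  if b + 2 < n then
    @identify (complete (n - b).-1.+1) (star b.+1) ord0 ord0
  else @subdivide (star (n - 2).+1) ord0 ord_max.

(* Main.v *)
Require Import Defs.
From mathcomp Require Import all_boot zify.

(* Fix a bridge uv of G and a side A of it (the edge uv is the only one leaving A),
   with |A| = a minimal among all bridges; the other b - 1 bridges then lie in
   G - A.  A connected set meeting both A and its complement contains u and v, so
   eta(G) <= 2^a - 1 + eta(G - A) + 2^(n-2).  By induction on b this yields
   eta(G) <= 2^(n-1) + 2^(n-b-1) + b - 1, and equality forces a = 1, v adjacent to
   every other vertex, and the extremal structure on G - u.  If b = n - 2, then G is
   disconnected, since a connected graph whose order exceeds its number of bridges
   by 2 would have one more bridge; the bound is then applied to both parts of G,
   which are trees. *)

Set Implicit Arguments.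
Unset Strict Implicit.
Unset Printing Implicit Defensive.

(** * Inequalities between powers of two *)

Lemma expn2_gt0 k : 0 < 2 ^ k. Proof. by rewrite expn_gt0. Qed.

(* The inductive step for a bridge side of order p + 1: z and y are the numbers of
   connected sets in V and V - A, and x counts the connected sets crossing the bridge. *)
Lemma strict_arith m m' p b x y z : m = m' + p -> 0 < p -> 0 < m' + b ->
  x <= 2 ^ (m + b) -> y.+1 <= 2 ^ (m' + b) + 2 ^ m' + b ->
  z <= (2 ^ p.+1).-1 + y + x -> z.+1 < 2 ^ (m + b.+1) + 2 ^ m + b.+1.
Proof.
move=> em p0 mb0 lex ley lez.
have P2 : 2 <= 2 ^ p by rewrite -{1}(expn1 2) leq_exp2l.
have Q2 : 2 <= 2 ^ (m' + b) by rewrite -{1}(expn1 2) leq_exp2l.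
have M0 := expn2_gt0 m'.
have e1 : 2 ^ (m + b) = 2 ^ p * 2 ^ (m' + b) by rewrite -expnD em addnAC addnC.
have e3 : 2 ^ m = 2 ^ p * 2 ^ m' by rewrite -expnD em addnC.
rewrite (addnS m) (expnS _ (m + b)) e1 e3; rewrite e1 in lex; rewrite expnS in lez.
move: (2 ^ p) (2 ^ (m' + b)) (2 ^ m') P2 Q2 M0 lex ley lez {e1 e3} => P Q M.
(* The claim reduces to (P - 1)(Q - 2) >= 0 together with M < P M. *)
nia.
Qed.

(** The inductive step for a side of order 1. The bound on z is the sum of those on x and y plus a
    constant, so equality forces equality in both. *)
Lemma pendant_arith m b x y z :
  x <= 2 ^ (m + b) -> y.+1 <= 2 ^ (m + b) + 2 ^ m + b ->
  z <= (2 ^ 1).-1 + y + x ->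
  z.+1 <= 2 ^ (m + b.+1) + 2 ^ m + b.+1 /\
  (z.+1 = 2 ^ (m + b.+1) + 2 ^ m + b.+1 ->
   y.+1 = 2 ^ (m + b) + 2 ^ m + b /\ x = 2 ^ (m + b)).
Proof.
rewrite (addnS m) (expnS _ (m + b)) /=; move: (2 ^ (m + b)) (2 ^ m) => Q M.
by lia.
Qed.

(** Amounts to (2^b - 1)(2^c - 1) >= 0. It compares two disjoint trees with b and c bridges to the
    bound for a disconnected graph. *)
Lemma tree_arith b c : 2 ^ b + b + (2 ^ c + c) <= 2 ^ (b + c) + (b + c).+1.
Proof.
have := expn2_gt0 b; have := expn2_gt0 c; rewrite expnD.
by move: (2 ^ b) (2 ^ c) => p q; nia.
Qed.

Lemma card_disjointU (I : finType) (X Y : {set I}) :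
  [disjoint X & Y] -> #|X :|: Y| = #|X| + #|Y|.
Proof. by move=> dXY; apply/eqP; rewrite (leq_card_setU X Y).2. Qed.

Section Graph.
Variable G : sgraph.
Implicit Types (u v w x y : G) (A B C D P S V E : {set G}) (F : {set {set G}}).

(** * Vertex sets that induce connected subgraphs *)

Definition separated A B := [forall x in A, forall y in B, ~~ adj x y].

Lemma separatedPn A B :
  reflect (exists x y, [/\ x \in A, y \in B & adj x y]) (~~ separated A B).
Proof.
apply: (iffP forall_inPn) => [[x xA /forall_inPn[y yB]]|[x [y [xA yB xy]]]].
  by rewrite negbK; exists x, y.
by exists x => //; apply/forall_inPn; exists y; rewrite ?negbK.
Qed.

Lemma separated_nadj A B x y : separated A B -> x \in A -> y \in B -> ~~ adj x y.
Proof. by move=> /forall_inP sAB xA yB; have /forall_inP/(_ y yB) := sAB x xA. Qed.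

Lemma separatedC A B : separated A B = separated B A.
Proof.
by apply: negb_inj; apply/separatedPn/separatedPn => -[x [y [xA yB]]];
  rewrite adj_sym => xy; exists y, x.
Qed.

(** Connectedness of the induced subgraph, phrased by edges leaving proper parts instead of paths,
    so that all sets stay inside [G]; [linkedE] relates it to [connected]. *)
Definition linked S := (S != set0) &&
  [forall C : {set G}, (C != set0) ==> (C \proper S) ==> ~~ separated C (S :\: C)].

Lemma linked_edge S C : linked S -> C != set0 -> C \proper S ->
  exists x y, [/\ x \in C, y \in S :\: C & adj x y].
Proof.
move=> /andP[_ /forallP/(_ C)] + C0 CS; rewrite C0 CS.
by move/separatedPn.
Qed.

Lemma linked_split S x y C : linked S -> x \in S :&: C -> y \in S :\: C ->
  exists x' y', [/\ x' \in S :&: C, y' \in S :\: C & adj x' y'].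
Proof.
move=> lS xSC ySC.
have [||x' [y' [x'SC y'SC xy]]] := linked_edge (C := S :&: C) lS.
- by apply/set0Pn; exists x.
- apply/properP; split; first exact: subsetIl.
  by exists y; move: ySC; rewrite !inE => /andP[/negPf yC yS]; rewrite ?yC ?andbF.
by exists x', y'; split=> //; move: y'SC; rewrite !inE; case: (y' \in S).
Qed.

Lemma linked1 x : linked [set x].
Proof.
apply/andP; split; first by apply/set0Pn; exists x; rewrite inE.
apply/forallP => C; apply/implyP => C0; apply/implyP.
by rewrite properE subset1 (negPf C0) orbF => /andP[/eqP->]; rewrite subxx.
Qed.

(** A partition of [S] either splits [D], and [D] supplies a crossing edge, or leaves [D] on one
    side, and a vertex of the other side has a neighbour in [D]. *)
Lemma linked_dominating D S : linked D -> D \subset S ->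
    (forall x, x \in S :\: D -> exists2 y, y \in D & adj x y) -> linked S.
Proof.
move=> lD DS dom; have /set0Pn[d dD]: D != set0 by case/andP: lD.
apply/andP; split; first by apply/set0Pn; exists d; exact: (subsetP DS).
apply/forallP => C; apply/implyP => /set0Pn[x xC]; apply/implyP => /properP[CS [y yS yC]].
apply/separatedPn.
have xS := subsetP CS _ xC.
case: (boolP [exists z in D, z \in C]) => [/exists_inP[z zD zC]|/exists_inPn noC]; last first.
  have [|z zD xz] := dom x; first by rewrite !inE xS andbT; apply/negP => /noC; rewrite xC.
  by exists x, z; split=> //; rewrite !inE (subsetP DS) // noC.
case: (boolP [exists w in D, w \notin C]) => [/exists_inP[w wD wC]|/exists_inPn allC]; last first.
  have [|z' z'D xz] := dom y; first by rewrite !inE yS andbT; apply/negP => /allC; rewrite yC.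
  exists z', y; split; [by have:= allC _ z'D; rewrite negbK | by rewrite !inE yC | by rewrite adj_sym].
have [||x' [y' [+ + xy]]] := @linked_split D z w C lD; rewrite ?inE ?zD ?zC ?wD ?wC //.
move=> /andP[x'D x'C] /andP[y'C y'D].
by exists x', y'; split; rewrite ?inE ?y'C ?(subsetP DS).
Qed.

Lemma linked_pair x y : linked [set x; y] -> x != y -> adj x y.
Proof.
move=> l xy.
have [||a [b [+ + ab]]] := @linked_split _ x y [set x] l; rewrite ?inE ?eqxx ?orbT //.
  by rewrite eq_sym xy.
move=> /andP[_ /eqP ax] /andP[bx]; rewrite (negPf bx) /= => /eqP bY.
by rewrite -ax -bY.
Qed.

Lemma card_between D V : D \subset V ->
  #|[set S : {set G} | (D \subset S) && (S \subset V)]| = 2 ^ #|V :\: D|.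
Proof.
move=> DV; rewrite -card_powerset.
have -> : [set S : {set G} | (D \subset S) && (S \subset V)]
          = (fun X => D :|: X) @: powerset (V :\: D).
  apply/setP => S; rewrite inE; apply/andP/imsetP => [[DS SV]|[X]].
    exists (S :\: D); first by rewrite inE setSD.
    by rewrite -{1}(setIidPr DS) setID.
  rewrite inE subsetD => /andP[XV _] ->.
  by rewrite subsetUl subUset DV.
apply: card_in_imset => X Y; rewrite !inE !subsetD => /andP[_ dX] /andP[_ dY] eXY.
have : (D :|: X) :\: D = (D :|: Y) :\: D by rewrite eXY.
by rewrite !setDUl !setDv !set0U !(setDidPl _).
Qed.

(** Counting relative to [V] lets the induction pass to [V :\: A] within the same graph. *)
Definition linked_in V := [set S : {set G} | (S \subset V) && linked S].
Definition eta_in V := #|linked_in V|.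

Lemma linked_in_sub V : linked_in V \subset powerset V :\ set0.
Proof.
by apply/subsetP => S; rewrite !inE => /andP[-> /andP[->]].
Qed.

Lemma card_powersetD1 V : #|powerset V :\ set0| = (2 ^ #|V|).-1.
Proof. by rewrite -card_powerset (cardsD1 set0 (powerset V)) inE sub0set. Qed.

(** * Bridges of an induced subgraph and their sides *)

(** [A] is a side of the bridge uv. It need not be connected: components that do not contain the
    bridge may lie on either side. *)
Definition cut V A u v := [&& A \subset V, u \in A, v \in V :\: A, adj u v &
  [forall x in A, forall y in V :\: A, adj x y ==> (x == u) && (y == v)]].

Lemma cutP V A u v :
  reflect [/\ A \subset V, u \in A, v \in V :\: A, adj u v &
    forall x y, x \in A -> y \in V :\: A -> adj x y -> x = u /\ y = v] (cut V A u v).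
Proof.
apply: (iffP and5P) => -[? ? ? ? H]; split=> //.
  move=> x y xA yV xy; move/forall_inP/(_ x xA)/forall_inP/(_ y yV): H.
  by rewrite xy => /andP[/eqP-> /eqP->].
apply/forall_inP => x xA; apply/forall_inP => y yV; apply/implyP => xy.
by have [-> ->] := H x y xA yV xy; rewrite !eqxx.
Qed.

Lemma setDDK V A : A \subset V -> V :\: (V :\: A) = A.
Proof. by move=> AV; rewrite setDDr setDv set0U; apply/setIidPr. Qed.

Lemma cutC V A u v : cut V A u v -> cut V (V :\: A) v u.
Proof.
case/cutP => AV uA vV uv H; apply/cutP; split; rewrite ?subsetDl ?setDDK //.
  by rewrite adj_sym.
by move=> x y xV yA; rewrite adj_sym => /H-/(_ yA xV)[].
Qed.

Lemma cutW V V' A u v : V' \subset V -> u \in V' -> v \in V' -> cut V A u v ->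
  cut V' (A :&: V') u v.
Proof.
move=> sV uV' vV' /cutP[AV uA]; rewrite inE => /andP[vA _] uv H.
apply/cutP; split; rewrite ?subsetIr ?inE ?uA ?uV' ?vV' ?andbT //.
move=> x y; rewrite !inE => /andP[xA xV] /andP[yA yV].
by apply: H => //; rewrite inE (subsetP sV) // andbT; move: yA; rewrite yV andbT.
Qed.

Definition bridge_in V E := [exists A, exists u, exists v, cut V A u v && (E == [set u; v])].

Lemma bridge_inP V E :
  reflect (exists A u v, cut V A u v /\ E = [set u; v]) (bridge_in V E).
Proof.
apply: (iffP existsP) => [[A /existsP[u /existsP[v /andP[c /eqP->]]]]|[A [u [v [c ->]]]]].
  by exists A, u, v.
by exists A; apply/existsP; exists u; apply/existsP; exists v; rewrite c eqxx.
Qed.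

Definition bridges_in V := [set E | bridge_in V E].

Lemma in_bridges V E : (E \in bridges_in V) = bridge_in V E.
Proof. exact: in_set. Qed.

(* A side of minimal cardinality contains no other bridge, as one of the two
   sides of such a bridge would be smaller. *)
Lemma peel V F : F \subset bridges_in V -> F != set0 ->
  exists A u v, [/\ cut V A u v, [set u; v] \in F, #|A| <= #|V :\: A| &
    F :\ [set u; v] \subset bridges_in (V :\: A)].
Proof.
move=> FV /set0Pn[E0 E0F].
pose Q (t : {set G} * G * G) := cut V t.1.1 t.1.2 t.2 && ([set t.1.2; t.2] \in F).
have [A0 [u0 [v0 [c0 E0E]]]] : exists A u v, cut V A u v /\ E0 = [set u; v].
  by apply/bridge_inP; have := subsetP FV _ E0F; rewrite inE.
have Q0 : Q (A0, u0, v0) by rewrite /Q /= c0 -E0E.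
case: (arg_minnP (fun t : {set G} * G * G => #|t.1.1|) Q0) => -[[A u] v] /andP[/= cA EF] minA.
have {}minA C x y : cut V C x y -> [set x; y] \in F -> #|A| <= #|C|.
  by move=> cC xyF; apply: (minA (C, x, y)); rewrite /Q /= cC.
exists A, u, v; split; [exact: cA|exact: EF| |].
  by apply: (minA _ v u (cutC cA)); rewrite setUC.
apply/subsetP => E /setD1P[Euv EE]; rewrite inE; apply/bridge_inP.
have /bridge_inP[C [x [y [cC Exy]]]] : bridge_in V E.
  by have := subsetP FV _ EE; rewrite inE.
wlog xV : C x y cC Exy / x \in V :\: A => [hw|].
  have [xV|xV] := boolP (x \in V :\: A); first exact: (hw C x y).
  have [yV|yV] := boolP (y \in V :\: A).
    by apply: (hw _ y x (cutC cC)); rewrite // setUC.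
  (* Both ends of [E] lie in [A]. Let [C] be the side of [E] that avoids [v]. Edges leave [A] only
     towards [v], so [C :&: A] is a side of [E] too; it misses [y], against the minimality of
     [A]. *)
  exfalso; wlog vC : C x y cC Exy xV yV / v \notin C => [hw2|].
    have [vC|] := boolP (v \in C); last exact: (hw2 C x y).
    by apply: (hw2 _ y x (cutC cC)); rewrite // ?in_setD ?vC // setUC.
  case/cutP: (cA) => AV uA vV uv HA; case/cutP: (cC) => CV xC; rewrite inE => /andP[yC yV'] xy HC.
  have xA : x \in A by move: xV; rewrite inE (subsetP CV) // andbT negbK.
  have yA : y \in A by move: yV; rewrite inE yV' andbT negbK.
  suff /minA : cut V (C :&: A) x y.
    rewrite -Exy => /(_ EE); rewrite leqNgt proper_card //.
    apply/properP; split; first exact: subsetIr.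
    by exists y => //; rewrite inE (negPf yC).
  apply/cutP; split; rewrite ?inE ?xC ?xA ?(negPf yC) ?yV' //.
    by rewrite subIset // CV.
  move=> z w; rewrite !inE => /andP[zC zA] /andP[wCA wV] zw.
  have [wC|wC] := boolP (w \in C); last by apply: HC => //; rewrite inE wC.
  rewrite wC /= in wCA.
  have [||//|_ wv] := HA z w; rewrite ?inE ?wCA //.
  by move: vC; rewrite -wv wC.
(* An edge between [x] outside [A] and [y] in [A] would be uv itself. *)
have yV : y \in V :\: A.
  case/cutP: (cC) => CV xC; rewrite !inE => /andP[yC yV] xy _; rewrite yV andbT.
  apply/negP => yA; case/cutP: cA => _ _ _ _ /(_ y x yA xV).
  by rewrite adj_sym => /(_ xy)[yu xv]; move: Euv; rewrite Exy yu xv setUC eqxx.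
by exists (C :&: (V :\: A)), x, y; split=> //; apply: cutW cC => //; apply: subsetDl.
Qed.

Lemma cardD1S F E b : #|F| = b.+1 -> E \in F -> #|F :\ E| = b.
Proof. by move=> cF EF; move: (cardsD1 E F); rewrite cF EF => -[]. Qed.

(** Peeling off a side discards one bridge of [F] and at least one vertex. *)
Lemma card_bridges_lt V F : F \subset bridges_in V -> V != set0 -> #|F| < #|V|.
Proof.
move eb: #|F| => b; elim: b => [|b IH] in V F eb *; first by rewrite card_gt0.
move=> FV V0; have [|A [u [v [cA EF _ F'V]]]] := peel FV; first by rewrite -card_gt0 eb.
case/cutP: cA => AV uA vV _ _.
have := IH _ _ (cardD1S eb EF) F'V; rewrite -(cardsID A V) (setIidPr AV).
have A0 : 0 < #|A| by apply/card_gt0P; exists u.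
have -> : V :\: A != set0 by apply/set0Pn; exists v.
by move/(_ isT); lia.
Qed.

(* [V] induces a complete graph with pendant edges from [c] to the vertices of [P]. *)
Definition broom V c P := [/\ c \in V :\: P, P \subset V &
  forall x y, x \in V -> y \in V ->
    adj x y = (x != y) && [|| x == c, y == c | (x \notin P) && (y \notin P)]].

(** * The upper bound and its equality case *)

(** A connected set lies in [A], or avoids [A], or crosses the cut and so contains both u and v. In
    the first case all nonempty subsets of [A] are counted. *)
Lemma cut_eta V A u v : cut V A u v ->
  eta_in V <= (2 ^ #|A|).-1 + eta_in (V :\: A)
    + #|linked_in V :&: [set S : {set G} | ([set u; v] \subset S) && (S \subset V)]|.
Proof.
case/cutP=> AV uA vV uv HA; rewrite /eta_in -card_powersetD1.
set X := [set S : {set G} | _].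
rewrite (leq_trans _ (leq_add (leq_card_setU _ _).1 (leqnn _))) //.
rewrite (leq_trans _ (leq_card_setU _ _).1) //.
apply: subset_leq_card; apply/subsetP => S; rewrite !inE => /andP[SV lS].
rewrite SV lS /= andbT; have S0 : S != set0 by case/andP: lS.
rewrite S0 /=; case: (boolP (S \subset A)) => //= /subsetPn[y yS yA].
have ySA : y \in S :\: A by rewrite inE yA yS.
rewrite subsetD SV /=; case: (boolP [disjoint S & A]) => //= /pred0Pn[x xSA].
have [|x' [y' [+ + xy]]] := linked_split lS (_ : x \in S :&: A) ySA; first by rewrite inE.
rewrite !inE => /andP[x'S x'A] /andP[y'A y'S].
have [//||<- <-] := HA x' y' _ _ xy; first by rewrite inE y'A (subsetP SV).
by rewrite ?andbT; apply/subsetP => z; rewrite !inE => /orP[] /eqP->.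
Qed.

(** Here m + 1 is the order of the clique in the extremal graph. [F] may be any set of bridges, so
    that the induction hypothesis applies to what [peel] leaves. *)
Lemma eta_in_max V m b F : F \subset bridges_in V -> #|F| = b -> #|V| = (m + b).+1 ->
  (eta_in V).+1 <= 2 ^ (m + b) + 2 ^ m + b /\
  ((eta_in V).+1 = 2 ^ (m + b) + 2 ^ m + b -> 1 < m ->
   exists c P, broom V c P /\ #|P| = b).
Proof.
elim: b => [|b IH] in V m F *.
  (* For empty [F] the bound counts all nonempty subsets. Under equality every pair is connected, so
     the graph is complete and any vertex can be the centre. *)
  move=> _ _; rewrite !addn0 => cV.
  have le := subset_leq_card (linked_in_sub V).
  rewrite card_powersetD1 cV -/(eta_in V) in le.
  have m0 := expn2_gt0 m; rewrite expnS in le *; split; first by lia.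
  move=> eqV _; have /card_gt0P[c cV'] : 0 < #|V| by rewrite cV.
  exists c, set0; split; last by rewrite cards0.
  split; rewrite ?sub0set ?inE // => x y xV yV; rewrite !inE !orbT andbT.
  have /eqP all : linked_in V == powerset V :\ set0.
    by rewrite eqEcard linked_in_sub card_powersetD1 cV -/(eta_in V) expnS; lia.
  have [->|xy] := eqVneq; first by rewrite adj_irr.
  apply: linked_pair => //.
  have : [set x; y] \in linked_in V.
    rewrite all !inE; apply/andP; split; first by apply/set0Pn; exists x; rewrite !inE eqxx.
    by apply/subsetP => z; rewrite !inE => /orP[] /eqP->.
  by rewrite inE => /andP[].
move=> FV cF cV; have [|A [u [v [cA EF Asmall F'V]]]] := peel FV; first by rewrite -card_gt0 cF.
have etaV := cut_eta cA; case/cutP: cA => AV uA vV uv HA.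
have cF' := cardD1S cF EF.
have := card_bridges_lt F'V; rewrite cF' => /(_ _)-ltB.
have {}ltB : b < #|V :\: A| by apply: ltB; apply/set0Pn; exists v.
have cAV : #|A| + #|V :\: A| = #|V| by rewrite -(cardsID A V) (setIidPr AV).
have A0 : 0 < #|A| by apply/card_gt0P; exists u.
(* The subtraction in [m'] is exact, since [V :\: A] has more than [b] vertices by
   [card_bridges_lt]. *)
pose p := #|A|.-1; pose m' := #|V :\: A| - b.+1.
have cA : #|A| = p.+1 by rewrite /p; lia.
have cVA : #|V :\: A| = (m' + b).+1 by rewrite /m'; lia.
have em : m = m' + p by lia.
have [bnd eqcase] := IH _ _ _ F'V cF' cVA.
move: etaV; set L := linked_in V; set X := [set S : {set G} | _] => etaV.
have uV := subsetP AV _ uA.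
have vV' : v \in V by move: vV; rewrite inE => /andP[].
have vA : v \notin A by move: vV; rewrite inE => /andP[].
have uvN : u != v by apply: contraNneq vA => <-.
have uvV : [set u; v] \subset V by apply/subsetP => z; rewrite !inE => /orP[] /eqP->.
have cX : #|X| = 2 ^ (m + b).
  by rewrite card_between // cardsD (setIidPr uvV) cards2 uvN cV addnS !subSS subn0.
have LX := subset_leq_card (subsetIr L X); rewrite cX in LX.
rewrite cA in etaV.
(* For |A| > 1 the bound is strict: [A] is the smaller side, so [V :\: A] also has more than one
   vertex, which gives m' + b > 0. *)
have [p0|p1] := posnP p; last first.
  have strict : (eta_in V).+1 < 2 ^ (m + b.+1) + 2 ^ m + b.+1.
    have mb0 : 0 < m' + b by rewrite -ltnS -cVA (leq_trans _ Asmall) // cA ltnS.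
    exact: (strict_arith em p1 mb0 LX bnd etaV).
  by split=> [|e]; [exact: ltnW | rewrite e ltnn in strict].
have mm : m' = m by rewrite em p0 addn0.
rewrite mm p0 in bnd eqcase etaV *.
have [le eqs] := pendant_arith LX bnd etaV; split=> [//|eqV m1].
have [/eqcase/(_ m1)[c [P [[cVP PV adjE] cP]]] eqX] := eqs eqV.
(* Under equality every subset of [V] containing u and v is connected. *)
have /eqP LXX : L :&: X == X by rewrite eqEcard subsetIr cX eqX leqnn.
have Au : A = [set u].
  by apply/eqP; rewrite eq_sym eqEcard cards1 sub1set uA cA p0.
have VA x : x \in V -> x != u -> x \in V :\: A by rewrite Au !inE => -> ->.
have adj_u x : x \in V :\: A -> adj u x = (x == v).
  by move=> xV; apply/idP/eqP => [/(HA u x uA xV)[]|->].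
(* The set {u, v, x} is connected, and u is adjacent to v only, so x must be adjacent to v. *)
have adj_v x : x \in V :\: A -> x != v -> adj v x.
  move=> xV xv; have := xV; rewrite !inE Au inE => /andP[xu xV'].
  have : [set u; v] :|: [set x] \in L :&: X.
    by rewrite LXX inE subsetUl subUset uvV sub1set.
  rewrite inE => /andP[+ _]; rewrite inE => /andP[_ lS].
  have [||x' [y' [+ + xy]]] := @linked_split _ u x [set u; v] lS.
  - by rewrite !inE eqxx.
  - by rewrite !inE eqxx !orbT (negPf xu) (negPf xv).
  rewrite !inE => /andP[_ +] /andP[/negPf->] /= => /orP[]/eqP ex /eqP ey.
    by move: xy; rewrite ex ey adj_u // (negPf xv).
  by rewrite -ex -ey.
(* The centre [c] from the induction hypothesis can be replaced by [v]. If they differ, [v] is not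
   pendant; being adjacent to all of [V :\: A], it leaves no pendant vertices, so [V :\: A] is
   complete. *)
have [vP brv] : v \notin P /\ forall x y, x \in V :\: A -> y \in V :\: A ->
    adj x y = (x != y) && [|| x == v, y == v | (x \notin P) && (y \notin P)].
  move: (cVP); rewrite inE => /andP[cnP cVA'].
  have [->//|vc] := eqVneq v c.
  have vP : v \notin P.
    apply/negP => vP.
    (* a third vertex outside [P], which exists because m > 1, is not adjacent to [v] *)
    have /card_gt0P[w] : 0 < #|((V :\: A) :\: P) :\ c|.
      have := cardsD1 c ((V :\: A) :\: P); rewrite cVP.
      rewrite cardsD (setIidPr PV) cP cVA mm -addSn addnK add1n => -[<-].
      exact: ltnW.
    rewrite 2!in_setD in_set1 => /and3P[wc wP wV'].
    have wv : v != w by apply: contraNneq wP => <-.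
    have := adj_v w wV'; rewrite eq_sym => /(_ wv).
    by rewrite adjE // (negPf vc) (negPf wc) vP /= andbF.
  split=> // x y xV yV.
  have P0' w : w \notin P.
    apply/negP => wP; have wVA := subsetP PV _ wP.
    have wv : w != v by apply: contraNneq vP => <-.
    have wc : w != c by apply: contraNneq cnP => <-.
    by have := adj_v w wVA wv; rewrite adjE // (negPf vc) (negPf wc) wP /= !andbF.
  by rewrite adjE // !P0' !orbT.
have uP : u \notin P by apply/negP => /(subsetP PV); rewrite inE uA.
have vu : (v == u) = false by rewrite eq_sym (negPf uvN).
exists v, (u |: P); split; last by rewrite cardsU1 uP cP.
split; rewrite ?inE ?(negPf vP) ?vu ?vV' //.
  by rewrite subUset sub1set uV (subset_trans PV) ?subsetDl.
move=> x y xV yV; rewrite !inE.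
have [->|xu] := eqVneq x u; have [->|yu] := eqVneq y u; rewrite ?eqxx /=.
- by rewrite adj_irr.
- by rewrite adj_u ?VA // (negPf uvN) orbF.
- by rewrite adj_sym adj_u ?VA // (negPf uvN) /= andbF orbF xu.
- by rewrite brv ?VA.
Qed.

(** * Connected and disconnected graphs with two vertices more than bridges *)

Lemma unlinked_split V : V != set0 -> ~~ linked V ->
  exists C, [/\ C != set0, C \proper V & separated C (V :\: C)].
Proof.
rewrite /linked => -> /= /forallPn[C]; rewrite 2!negb_imply negbK => /and3P[C0 CV sC].
by exists C.
Qed.

(** A part of [V :\: A] that avoids v has no neighbour in [A]; if it had none in the rest of
    [V :\: A] either, it would disconnect [V]. *)
Lemma linked_cut V A u v : linked V -> cut V A u v -> linked (V :\: A).
Proof.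
move=> lV /cutP[AV uA vV uv HA]; apply: contraT => /unlinked_split[|C [C0 CB sC]].
  by apply/set0Pn; exists v.
wlog vC : C C0 CB sC / v \notin C => [hw|].
  have [vC|] := boolP (v \in C); last exact: (hw C).
  apply: (hw (V :\: A :\: C)); last by rewrite inE vC.
  - by have /properP[_ [y yB yC]] := CB; apply/set0Pn; exists y; rewrite in_setD yC ?yB ?yV.
  - apply/properP; split; first exact: subsetDl.
    by exists v => //; rewrite inE vC.
  - rewrite setDDK; [by rewrite separatedC | by case/properP: CB].
have [CsB _] := properP CB.
have CV : C \proper V.
  exact: proper_sub_trans CB (subsetDl _ _).
have [x [y [xC yV xy]]] := linked_edge lV C0 CV.
suff yVC : y \in V :\: A :\: C by move: xy; rewrite (negPf (separated_nadj sC xC yVC)).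
move: yV; rewrite !inE => /andP[-> yV]; rewrite yV andbT.
apply: contra vC => yA.
by have [|_ <-] := HA y x yA (subsetP CsB _ xC); first by rewrite adj_sym.
Qed.

Lemma bridge_in_sub V E : bridge_in V E -> E \subset V.
Proof.
case/bridge_inP => A [u [v [/cutP[AV uA]]]]; rewrite inE => /andP[_ vV] _ _ ->.
by apply/subsetP => z; rewrite !inE => /orP[] /eqP-> //; apply: (subsetP AV).
Qed.

(** The side of [E] that avoids v has no neighbour in [A], hence is a side of [E] in [V] as well. *)
Lemma bridge_in_cut V A u v E : cut V A u v -> bridge_in (V :\: A) E -> bridge_in V E.
Proof.
move=> /cutP[AV uA vV uv HA] /bridge_inP[C [x [y [cC Exy]]]].
wlog vC : C x y cC Exy / v \notin C => [hw|].
  have [vC|] := boolP (v \in C); last exact: (hw C x y).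
  by apply: (hw _ y x (cutC cC)); rewrite ?inE ?vC // setUC.
case/cutP: cC => CB xC; rewrite !inE => /and3P[yC yA yV] xy HC.
apply/bridge_inP; exists C, x, y; split=> //; apply/cutP; split=> //.
- exact: subset_trans CB (subsetDl _ _).
- by rewrite inE yC.
move=> z w zC; rewrite inE => /andP[wC wV] zw; apply: HC => //.
rewrite !inE wC wV andbT; apply: contra vC => wA.
by have [|_ <-] := HA w z wA (subsetP CB _ zC); first by rewrite adj_sym.
Qed.

Lemma linked_card2 V : linked V -> #|V| = 2 -> bridge_in V V.
Proof.
move=> lV /eqP/cards2P[x [y [xy eV]]]; apply/bridge_inP; exists [set x], x, y.
split=> //; apply/cutP; split; rewrite ?eV ?sub1set ?inE ?eqxx ?orbT //.
- by rewrite eq_sym xy.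
- by apply: linked_pair xy; rewrite -eV.
by move=> z w; rewrite !inE => /eqP-> /andP[/negPf->] /= /eqP.
Qed.

(** After peeling, the orders leave two cases: |A| = 1, where induction applies to [V :\: A], or |A|
    = 2, where the edge inside [A] is a new bridge. *)
Lemma extra_bridge V F : linked V -> F \subset bridges_in V -> #|V| = #|F|.+2 ->
  exists2 E, bridge_in V E & E \notin F.
Proof.
move eb: #|F| => b; elim: b => [|b IH] in V F eb *.
  move=> lV _ cV; exists V; first exact: linked_card2.
  by rewrite (cards0_eq eb) inE.
move=> lV FV cV; have [|A [u [v [cA EF _ F'B]]]] := peel FV; first by rewrite -card_gt0 eb.
have cF' := cardD1S eb EF; have lB := linked_cut lV cA; have cA' := cutC cA.
have lA := linked_cut lV cA'.
have := cA => /cutP[AV uA vV _ _]; rewrite setDDK // in lA.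
have ltB : #|F :\ [set u; v]| < #|V :\: A|.
  by apply: card_bridges_lt => //; case/andP: lB.
have cAV : #|A| + #|V :\: A| = #|V| by rewrite -(cardsID A V) (setIidPr AV).
have A0 : 0 < #|A| by apply/card_gt0P; exists u.
rewrite cF' cV in ltB cAV.
have uB : u \notin V :\: A by rewrite inE uA.
have [[A1 B1]|A2] : #|A| = 1 /\ #|V :\: A| = b.+2 \/ #|A| = 2.
  by move: ltB cAV A0; clear; lia.
  have [E bE EF'] := IH _ _ cF' lB F'B B1.
  exists E; first exact: bridge_in_cut cA bE.
  apply: contra EF' => EE; rewrite !inE EE andbT.
  by apply: contraNneq uB => Euv; apply: (subsetP (bridge_in_sub bE)); rewrite Euv !inE eqxx.
have bA := linked_card2 lA A2.
exists A; first by apply: (bridge_in_cut cA'); rewrite setDDK.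
(* As an edge, [A] is not in [F]: the members of [F] other than uv lie in [V :\: A]. *)
apply/negP => AF; have [Auv|Auv] := eqVneq A [set u; v].
  by move: vV; rewrite Auv !inE eqxx orbT.
have /subsetP/(_ _ uA) : A \subset V :\: A; last by rewrite (negPf uB).
apply: bridge_in_sub; have := subsetP F'B A.
by rewrite !inE Auv AF => ->.
Qed.

Lemma separated_eta V C : C \subset V -> separated C (V :\: C) ->
  eta_in V <= eta_in C + eta_in (V :\: C).
Proof.
move=> CV sC; rewrite /eta_in (leq_trans _ (leq_card_setU _ _).1) //.
apply: subset_leq_card; apply/subsetP => S; rewrite !inE => /andP[SV lS].
rewrite lS !andbT; case: (boolP (S \subset C)) => //= /subsetPn[y yS yC].
rewrite subsetD SV; apply: contraT => /pred0Pn[x xSC].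
have [||x' [y' [+ + xy]]] := @linked_split S x y C lS.
- by rewrite in_setI.
- by rewrite in_setD yC.
rewrite !inE => /andP[x'S x'C] /andP[y'C y'S].
suff yVC : y' \in V :\: C by move: xy; rewrite (negPf (separated_nadj sC x'C yVC)).
by rewrite inE y'C (subsetP SV).
Qed.

Lemma separated_bridge V C E : C \subset V -> separated C (V :\: C) ->
  bridge_in V E -> bridge_in C E || bridge_in (V :\: C) E.
Proof.
move=> CV sC /bridge_inP[A [u [v [cA Euv]]]].
have /cutP[AV uA vV uv HA] := cA.
have vV' : v \in V by move: vV; rewrite inE => /andP[].
have uV := subsetP AV _ uA.
have [uC|uC] := boolP (u \in C); have [vC|vC] := boolP (v \in C).
- by apply/orP; left; apply/bridge_inP; exists (A :&: C), u, v; split=> //; apply: cutW cA.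
- by move: uv; rewrite (negPf (separated_nadj sC uC _)) // inE vC.
- by move: uv; rewrite adj_sym (negPf (separated_nadj sC vC _)) // inE uC.
apply/orP; right; apply/bridge_inP; exists (A :&: (V :\: C)), u, v; split => //.
by apply: cutW cA; rewrite ?subsetDl // inE ?uC ?vC.
Qed.

Lemma eta_in_tree V F : F \subset bridges_in V -> #|V| = #|F|.+1 ->
  eta_in V <= 2 ^ #|F| + #|F|.
Proof.
move=> FV cV; have [+ _] := eta_in_max (m := 0) FV erefl cV.
by rewrite expn0 addn1 addSn.
Qed.

(** Split [V] into two separated parts. Each has fewer bridges than vertices, and the orders add up
    to |F| + 2, so each has exactly one vertex more than bridges and [eta_in_tree] applies. *)
Lemma eta_in_unlinked V F : F \subset bridges_in V -> #|V| = #|F|.+2 -> ~~ linked V ->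
  eta_in V <= 2 ^ #|F| + #|F|.+1.
Proof.
move=> FV cV /unlinked_split[|C [C0 CV sC]]; first by rewrite -card_gt0 cV.
have [CsV [y yV yC]] := properP CV.
have D0 : V :\: C != set0 by apply/set0Pn; exists y; rewrite in_setD yC yV.
have := separated_eta CsV sC.
have {sC} : F \subset bridges_in C :|: bridges_in (V :\: C).
  apply/subsetP => E /(subsetP FV) EV.
  rewrite in_bridges in EV.
  by apply/setUP; case/orP: (separated_bridge CsV sC EV) => ?; [left|right]; rewrite in_bridges.
have : #|C| + #|V :\: C| = #|F|.+2 by rewrite -cV -(cardsID C V) (setIidPr CsV).
move: (V :\: C) D0 => D D0 cCD /setIidPl eF etaV.
have [F1 [F2 [F1C F2D leF]]] : exists F1 F2, [/\ F1 \subset bridges_in C,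
    F2 \subset bridges_in D & #|F| <= #|F1| + #|F2|].
  exists (F :&: bridges_in C), (F :&: bridges_in D); split; [exact: subsetIr..|].
  by rewrite -{1}eF setIUr (leq_card_setU _ _).1.
have lt1 := card_bridges_lt F1C C0; have lt2 := card_bridges_lt F2D D0.
have [e1 [e2 e3]] : #|C| = #|F1|.+1 /\ #|D| = #|F2|.+1 /\ #|F| = #|F1| + #|F2|.
  by move: leF lt1 lt2 cCD; clear; lia.
rewrite e3; apply: leq_trans etaV (leq_trans (leq_add (eta_in_tree F1C e1) (eta_in_tree F2D e2)) _).
exact: tree_arith.
Qed.

(** * Connected sets of the extremal graph *)

(** Three disjoint families of connected sets: those containing the centre, the nonempty sets of
    other clique vertices, and the pendant singletons. *)
Lemma broom_eta V c P m b : broom V c P -> #|P| = b -> #|V| = (m + b).+1 ->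
  2 ^ (m + b) + 2 ^ m + b <= (eta_in V).+1.
Proof.
move=> [cVP PV adjE] cP cV; move: cVP; rewrite inE => /andP[cnP cV'].
pose X1 := [set S : {set G} | ([set c] \subset S) && (S \subset V)].
pose X2 := powerset (V :\: P :\ c) :\ set0.
pose X3 := [set [set x] | x in P].
have c1 : #|X1| = 2 ^ (m + b).
  rewrite card_between ?sub1set //; congr (2 ^ _).
  by have := cardsD1 c V; rewrite cV' cV add1n => -[].
have c2 : #|X2| = (2 ^ m).-1.
  rewrite card_powersetD1; congr (2 ^ _).-1.
  have := cardsD1 c (V :\: P); rewrite !inE cV' cnP cardsD (setIidPr PV) cV cP.
  by rewrite -addSn addnK add1n => -[].
have c3 : #|X3| = b by rewrite card_imset //; exact: set1_inj.
have d12 : [disjoint X1 & X2].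
  apply/pred0P => S /=; rewrite !inE sub1set; apply/negP => /andP[/andP[cS _] /andP[_ SV]].
  by have := subsetP SV _ cS; rewrite !inE eqxx.
have d3 : [disjoint X1 :|: X2 & X3].
  apply/pred0P => S /=; apply/negP => /andP[+ /imsetP[x xP eS]].
  rewrite !inE eS !sub1set !inE xP andbF andbF orbF => /andP[/eqP cx _].
  by rewrite cx xP in cnP.
have : X1 :|: X2 :|: X3 \subset linked_in V.
  rewrite !subUset -andbA; apply/and3P; split; apply/subsetP => S.
  - rewrite !inE => /andP[cS SV]; rewrite SV; apply: linked_dominating (linked1 c) cS _.
    move=> x; rewrite !inE => /andP[xc xS]; exists c; rewrite ?inE ?eqxx //.
    by rewrite adjE // ?(subsetP SV) // xc eqxx orbT.
  - rewrite !inE => /andP[/set0Pn[d dS] SV].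
    have inV x : x \in S -> [/\ x \in V, x \notin P & x != c].
      by move/(subsetP SV); rewrite !inE => /and3P[? ? ?].
    apply/andP; split; first by apply/subsetP => x /inV[].
    apply: linked_dominating (linked1 d) _ _; first by rewrite sub1set.
    move=> x; rewrite !inE => /andP[xd xS]; exists d; rewrite ?inE //.
    by have [xV xP _] := inV x xS; have [dV dP _] := inV d dS; rewrite adjE // xd xP dP !orbT.
  - by case/imsetP => x xP ->; rewrite inE sub1set (subsetP PV) ?linked1.
move/subset_leq_card; rewrite -/(eta_in V).
rewrite card_disjointU // c3 card_disjointU // c1 c2.
by have := expn2_gt0 m; lia.
Qed.

(** * Agreement with [connected], [eta] and [bridges] *)

Lemma linkedE S : linked S = (S != set0) && connected (induced S).
Proof.
apply/idP/andP => [lS|[S0 /forallP conn]].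
  split; first by case/andP: lS.
  apply/forallP => x; apply/forallP => y; apply: contraT => xy.
  (* The vertices reachable from [x] inside [S], as a set of vertices of [G]; no edge of [S] leaves
     it. *)
  pose C := [set z | [exists t : induced S, (val t == z) && connect adj x t]].
  have inC (t : induced S) : (val t \in C) = connect adj x t.
    rewrite inE; apply/existsP/idP => [[t' /andP[/eqP/val_inj-> //]]|xt].
    by exists t; rewrite eqxx.
  have [||x' [y' [+ + xy']]] := @linked_split S (val x) (val y) C lS.
  - by rewrite in_setI inC connect0 (valP x).
  - by rewrite in_setD inC xy (valP y).
  rewrite in_setI in_setD => /andP[x'S x'C] /andP[/negP y'C y'S]; case: y'C.
  rewrite -[x']/(val (Sub x' x'S : induced S)) inC in x'C.
  rewrite -[y']/(val (Sub y' y'S : induced S)) inC.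
  by apply: connect_trans x'C (connect1 _).
apply/andP; split=> //; apply/forallP => C; apply/implyP => /set0Pn[x xC].
apply/implyP => /properP[CS [y yS yC]]; apply/negP => sC.
have xS := subsetP CS _ xC.
have /forallP/(_ (Sub y yS)) := conn (Sub x xS).
have clC : closed (@adj (induced S)) [pred t : induced S | val t \in C].
  apply: intro_closed => [|s t st sC']; first exact/sym_connect_sym/adj_sym.
  apply: contraT => tC; suff tSC : val t \in S :\: C.
    by have := separated_nadj sC sC' tSC; rewrite [adj _ _]st.
  by rewrite in_setD (valP t) andbT.
by move/(closed_connect clC); rewrite !inE /= xC (negPf yC).
Qed.

Lemma eta_setT : eta G = eta_in [set: G].
Proof.
rewrite /eta /eta_in; congr #|pred_of_set _|.
by apply/setP => S; rewrite !inE subsetT linkedE.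
Qed.

Lemma connect_deleteW E x y : connect (@adj (delete_edge E)) x y -> connect (@adj G) x y.
Proof. by apply: connect_sub => a b /andP[ab _]; apply: connect1. Qed.

Lemma cut_connectF A u v : cut [set: G] A u v ->
  ~~ connect (@adj (delete_edge [set u; v])) u v.
Proof.
case/cutP => _ uA; rewrite inE => /andP[vA _] uv HA.
have clA : closed (@adj (delete_edge [set u; v])) [pred x in A].
  apply: intro_closed => [|s t /andP[st stE] sA].
    exact/sym_connect_sym/adj_sym.
  apply: contraT => tA; have [|su tv] := HA s t sA _ st; first by rewrite !inE tA.
  by rewrite su tv eqxx in stE.
by apply/negP => /(closed_connect clA); rewrite !inE uA (negPf vA).
Qed.

(** If u and v stay connected, reachability is unchanged. Otherwise components are counted by their
    roots, and the old roots inject into the new ones without being onto. *)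
Lemma components_delete u v : adj u v ->
  (components G < components (delete_edge [set u; v])) =
  ~~ connect (@adj (delete_edge [set u; v])) u v.
Proof.
move=> uv; set E := [set u; v]; pose e' := @adj (delete_edge E).
have symG : connect_sym (@adj G) by exact/sym_connect_sym/adj_sym.
have symE : connect_sym e' by exact/sym_connect_sym/adj_sym.
have adjE x y : adj x y -> e' x y || ([set x; y] == E).
  by rewrite /e' /= /delete_adj => ->; case: eqP.
rewrite /components -/e'; have [uvE|uvE] := boolP (connect e' u v).
  suff eqc : connect (@adj G) =2 connect e' by rewrite (eq_n_comp eqc) ltnn.
  move=> x y; apply/idP/idP; last exact: connect_deleteW.
  apply: connect_sub => a b /adjE/orP[/connect1//|/eqP abE].
  have : a \in E by rewrite -abE !inE eqxx.
  have : b \in E by rewrite -abE !inE eqxx orbT.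
  rewrite !inE => /orP[]/eqP-> /orP[]/eqP->; rewrite ?connect0 //.
  by rewrite symE.
pose R (e : rel G) := [set x | root e x == x].
have ncE (e : rel G) : n_comp e G = #|R e|.
  by rewrite /n_comp_mem; apply: eq_card => x; rewrite !inE andbT.
rewrite !ncE; pose f := root e'.
have inj : {in R (@adj G) &, injective f}.
  move=> x y; rewrite !inE => /eqP rx /eqP ry /eqP.
  by rewrite /f (root_connect symE) => /connect_deleteW/(rootP symG); rewrite rx ry.
rewrite -(card_in_imset inj) proper_card //; apply/properP; split.
  apply/subsetP => _ /imsetP[x _ ->]; rewrite inE /f.
  by rewrite (root_root symE).
have uvG : root (@adj G) u = root (@adj G) v by apply/(rootP symG)/connect1.
have notin w x : root e' w = root e' x -> root (@adj G) x = x -> x = root (@adj G) w.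
  by move=> /(rootP symE)/connect_deleteW/(rootP symG)-> ->.
(* In [G] the vertices u and v share one root, so the image of [f] cannot contain the new roots of
   both. *)
have [ru|ru] := boolP (f u \in f @: R (@adj G)); last first.
  by exists (f u) => //; rewrite inE /f (root_root symE).
exists (f v); first by rewrite inE /f (root_root symE).
apply/negP => /imsetP[y]; case/imsetP: ru => x.
rewrite !inE => /eqP rx fux /eqP ry fvy.
have exy : x = y by rewrite (notin u x) // (notin v y).
by case/negP: uvE; apply/(rootP symE); rewrite -/(f u) fux exy -fvy.
Qed.

Lemma bridgesE : bridges G = bridges_in [set: G].
Proof.
apply/setP => E; rewrite in_bridges inE; apply/andP/bridge_inP.
  case=> /imset2P[u v _ uv ->]; rewrite components_delete // => uvE.
  (* The side of u consists of what u still reaches once the edge is deleted. *)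
  pose A := [set x | connect (@adj (delete_edge [set u; v])) u x].
  exists A, u, v; split=> //; apply/cutP; split=> //.
  - by rewrite inE connect0.
  - by rewrite !inE andbT.
  move=> x y; rewrite !inE andbT => ux uy xy.
  have [exy|nxy] := eqVneq [set x; y] [set u; v]; last first.
    by case/negP: uy; apply: connect_trans ux (connect1 _); apply/andP.
  have := set21 x y; have := set22 x y; rewrite exy !inE.
  move=> /orP[/eqP yu|/eqP->]; first by rewrite yu connect0 in uy.
  by move=> /orP[/eqP->//|/eqP xv]; rewrite xv (negPf uvE) in ux.
case=> A [u [v [cA ->]]]; have /cutP[_ _ _ uv _] := cA.
split; last by rewrite components_delete ?(cut_connectF cA).
by apply/imset2P; exists u v.
Qed.

End Graph.

(** * Uniqueness of the extremal graph and the graphs [J] *)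

(** Adjacency depends only on which vertices are the centre or pendant, so any bijection that
    respects these roles is an isomorphism. *)
Lemma broom_isomorphic (G H : sgraph) (c : G) (P : {set G}) (c' : H) (P' : {set H}) :
  broom [set: G] c P -> broom [set: H] c' P' -> #|G| = #|H| -> #|P| = #|P'| ->
  isomorphic G H.
Proof.
move=> [cP _ adjG] [cP' _ adjH] eqGH cPP'.
(* Each graph is listed as centre, pendant vertices, remaining vertices; [f] matches equal
   positions. The default [c'] of [nth] is never reached, by [ltf]. *)
pose s (K : sgraph) (z : K) (Q : {set K}) := z :: enum Q ++ enum (~: (z |: Q)).
have s_perm (K : sgraph) (z : K) (Q : {set K}) : z \in [set: K] :\: Q ->
    (forall x, x \in s K z Q) /\ size (s K z Q) = #|K|.
  rewrite inE => /andP[zQ _]; split=> [x|].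
    by rewrite inE mem_cat !mem_enum !inE; case: (x == z); case: (x \in Q).
  by rewrite /= size_cat -!cardE -(cardsC (z |: Q)) cardsU1 zQ.
have [memG sizeG] := s_perm G c P cP; have [memH sizeH] := s_perm H c' P' cP'.
pose f x := nth c' (s H c' P') (index x (s G c P)).
have ltf x : index x (s G c P) < size (s H c' P') by rewrite sizeH -eqGH -sizeG index_mem.
have uniqH : uniq (s H c' P').
  by apply/card_uniqP; rewrite sizeH; apply: eq_card => x; rewrite memH.
have injf : injective f.
  move=> x y /eqP; rewrite nth_uniq ?ltf // => /eqP exy.
  by rewrite -(nth_index c (memG x)) exy nth_index.
have fc : f c = c' by rewrite /f /= eqxx.
have fP : f @: P = P'.
  apply/eqP; rewrite eqEcard card_imset // cPP' leqnn andbT.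
  apply/subsetP => _ /imsetP[x xP ->]; rewrite /f /=.
  have -> : (c == x) = false.
    by apply: contraTF cP => /eqP->; rewrite inE xP.
  have xe : x \in enum P by rewrite mem_enum.
  rewrite /= index_cat xe nth_cat -cardE -cPP' cardE index_mem xe -mem_enum mem_nth //.
  by rewrite -cardE -cPP' cardE index_mem.
exists f; first by apply: inj_card_bij; rewrite ?eqGH.
move=> x y; rewrite adjG ?adjH ?inE // -fc -fP !(inj_eq injf).
by rewrite !(mem_imset _ _ injf).
Qed.

Section Broom.
Variables m b : nat.
Let H := @identify (complete m.+1) (star b.+1) ord0 ord0.

Definition pendants : {set H} := [set p | if p is inl _ then false else true].

Lemma card_pendants : #|pendants| = b.
Proof.
have -> : pendants = inr @: [set: {y : star b.+1 | y != ord0}].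
  apply/setP => -[x|y]; rewrite !inE; first by apply/esym/imsetP => -[].
  by apply/esym/imsetP; exists y.
rewrite card_imset; last by move=> ? ? [].
by rewrite cardsT card_sig (cardC1 (ord0 : 'I_b.+1)) card_ord.
Qed.

Lemma card_identify : #|[set: H]| = (m + b).+1.
Proof.
by rewrite cardsT card_sum card_ord card_sig (cardC1 (ord0 : 'I_b.+1)) card_ord.
Qed.

Lemma identify_broom : broom [set: H] (inl ord0) pendants.
Proof.
have nz (z : {z : star b.+1 | z != ord0}) :
    (ord0 == val z) = false /\ (val (val z) == 0) = false.
  by split; [rewrite eq_sym |]; exact: negPf (valP z).
split; rewrite ?subsetT ?inE // => -[x|x] [y|y] _ _;
  rewrite !inE ?orbT ?andbT ?andbF ?orbF //= /star_adj.
- by rewrite (nz y).1 /= andbT.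
- by rewrite (nz x).1 /= andbT.
- by rewrite (nz x).2 (nz y).2 andbF.
Qed.
End Broom.

(** Counts the sets containing both the centre and the inserted vertex, and the singletons. The
    total exceeds the bound of [eta_in_unlinked] by one. *)
Lemma subdivided_star_eta b :
  2 ^ b + b.+2 <= eta (@subdivide (star b.+1) ord0 ord_max).
Proof.
set H := subdivide _ _; rewrite eta_setT.
have cH : #|H| = b.+2 by rewrite card_option card_ord.
pose D : {set H} := [set Some ord0; None].
have lD : linked D.
  apply: linked_dominating (linked1 (None : H)) _ _.
    by rewrite sub1set !inE.
  move=> x; rewrite !inE => /andP[/negPf-> /orP[/eqP->|//]].
  by exists None; rewrite ?inE //= !inE.
pose X1 := [set S : {set H} | (D \subset S) && (S \subset [set: H])].
pose X2 := [set [set x] | x : H].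
have c1 : #|X1| = 2 ^ b.
  by rewrite card_between ?subsetT // cardsD setTI cardsT cH cards2 subn2.
have c2 : #|X2| = b.+2 by rewrite card_imset ?cardsT ?cH //; exact: set1_inj.
have d12 : [disjoint X1 & X2].
  apply/pred0P => S /=; rewrite inE; apply/negP => /andP[/andP[DS _] /imsetP[x _ eS]].
  by move: DS; rewrite eS subUset !sub1set !inE => /andP[/eqP<-].
rewrite -c1 -c2 -card_disjointU //; apply/subset_leq_card.
rewrite subUset; apply/andP; split; apply/subsetP => S; last first.
  by case/imsetP => x _ ->; rewrite inE subsetT linked1.
rewrite !inE subsetT andbT => DS; apply: linked_dominating lD DS _.
case=> [i|]; rewrite !inE //= orbF => /andP[i0 _].
have {}i0 : i != ord0 by [].
(* The leaf [ord_max] is attached through the inserted vertex, every other leaf directly to the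
   centre. *)
have [->|im] := eqVneq i ord_max.
  by exists None; rewrite /= !inE ?eqxx ?orbT.
exists (Some ord0); rewrite /= ?inE ?eqxx // /star_adj i0 /= orbT /=.
apply: contra im => /eqP/setP/(_ i).
by rewrite !inE eqxx (negPf i0) /=.
Qed.

Theorem theorem2p5 (n b : nat) (n_gt0 : 0 < n) (b_gt0 : 0 < b)
    (le_b_n : b + 2 <= n) (G : sgraph) (order_G : #|G| = n)
    (bridges_G : #|bridges G| = b) (nonisomorphic : ~ isomorphic G (J n b)) :
  eta G < eta (J n b).
Proof.
have cG : #|[set: G]| = n by rewrite cardsT.
have FG : bridges G \subset bridges_in [set: G] by rewrite bridgesE.
rewrite eta_setT; move: nonisomorphic; rewrite /J; case: ifPn => [lt_b_n|].
  (* From b + 2 < n follows m > 1, as the equality case of [eta_in_max] demands. *)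
  have [m [-> en]] : exists m, (n - b).-1 = m /\ n = (m + b).+1.
    by exists (n - b).-1; split=> //; lia.
  rewrite en in cG; have [le eqG] := eta_in_max FG bridges_G cG.
  have brJ := identify_broom m b; have cJ := card_identify m b.
  move=> niso; rewrite eta_setT -ltnS.
  apply: leq_trans (broom_eta brJ (card_pendants m b) cJ).
  rewrite ltn_neqAle le andbT; apply/eqP => /eqG[|c [P [brG cP]]]; first by lia.
  apply: niso; apply: broom_isomorphic brG brJ _ _.
    by rewrite -cardsT cG -cJ cardsT.
  by rewrite cP card_pendants.
rewrite -leqNgt => le_n_b _.
have en : n = b.+2 by apply/eqP; rewrite eqn_leq -addn2 le_n_b le_b_n.
have -> : n - 2 = b by rewrite en subn2.
apply: leq_trans (subdivided_star_eta b); rewrite addnS ltnS -bridges_G.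
apply: eta_in_unlinked => //; first by rewrite cG bridges_G.
(* If [G] were connected, it would have a bridge outside [bridges G]. *)
apply/negP => /extra_bridge/(_ FG)[|E bE]; first by rewrite cG bridges_G.
by rewrite bridgesE in_bridges bE.
Qed.
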